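(* Let $t\geq 2$ be an integer, $m=4t+2$ and $n=2^m+1$. Put $\delta_1=\frac{n}{5}$, $\delta_2=2^{4t-1}+\frac{2^{4t}-1}{5}$, $\delta_3=\delta_2-6$; if $t=2$ put $\delta_4=\delta_2-8$, $\delta_5=\delta_2-24$, and if $t>2$ put $\delta_4=\delta_2-96$, $\delta_5=\delta_2-102$. Then $\delta_1,\delta_2,\delta_3,\delta_4,\delta_5$ are respectively the first, second, third, fourth and fifth largest coset leaders modulo $n$ (i.e. they are coset leaders, and every coset leader $x$ with $\delta_5<x\leq n-1$ belongs to $\{\delta_1,\delta_2,\delta_3,\delta_4\}$).
   Context: For $n=2^m+1$ and an integer $x$, the 2-cyclotomic coset of $x$ modulo $n$ is $C_x=\{x\cdot 2^{j} \bmod n : j\geq 0\}\subseteq\{0,1,\dots,n-1\}$. For $0\leq x\leq n-1$, ''$x$ is a coset leader'' means that $x$ is the smallest element of $C_x$. *)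

(* Defs.v *)
From mathcomp Require Import all_boot.
Set Implicit Arguments. Unset Strict Implicit. Unset Printing Implicit Defensive.

Definition in_coset (n x y : nat) : Prop := exists j : nat, y = (x * 2 ^ j) %% n.

(* x (with 0 <= x <= n-1) is a coset leader: x is the smallest element of C_x.
   Note x = x*2^0 mod n is in C_x since x < n. *)
Definition coset_leader (n x : nat) : Prop :=
  x < n /\ forall y, in_coset n x y -> x <= y.

(* Main.v *)
Require Import Defs.
From mathcomp Require Import all_boot.
From mathcomp Require Import zify.

(** If [x] is a coset leader, then, [2 ^ m] being [-1] modulo [n], every
    multiple [2 ^ j * x] is at distance at least [x] from the multiples of [n].
    Following [x], [2 x], [4 x], [16 x] confines [x] to [{n / 5}] or to
    [x <= 3 n / 17]; the interval [[7 n / 40, n / 5]] is stable under the step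
    [u |-> |16 u - 3 n|], and closing the orbit with [2 ^ (4 t + 2) = -1]
    forces [x = n / 5] there.  The remaining candidates are [d2 - s] with [s]
    small.  For them it suffices to know [r = x mod 2 ^ c] for each [c]: dividing
    by [2 ^ c] modulo [n] sends [- x] to [(r * n - x) / 2 ^ c], and
    [d2] is [B333...3] in hexadecimal. *)

(** * Gap and residue criteria for coset leaders *)

Lemma leader_gap {m x} (n := 2 ^ m + 1) : coset_leader n x -> 0 < x ->
  forall j q, 2 ^ j * x + x <= q * n \/ q * n + x <= 2 ^ j * x.
Proof.
move=> [x_lt_n leadx] x_gt0 j q.
have n_gt0 : 0 < n by rewrite /n addn1.
have pos := leadx _ (ex_intro _ j erefl); have neg := leadx _ (ex_intro _ (j + m) erefl).
(* The exponents [j] and [j + m] give opposite residues modulo [n]. *)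
have Ex : x * 2 ^ (j + m) + 2 ^ j * x = 2 ^ j * x * n.
  by rewrite /n expnD; lia.
rewrite mulnC in pos; set P := 2 ^ j * x in pos Ex *.
have := divn_eq P n; have := ltn_pmod P n_gt0.
set h := P %/ n; set r := P %% n in pos * => r_lt_n EP.
have En : (x * 2 ^ (j + m)) %% n = n - r.
  have -> : x * 2 ^ (j + m) = (P - h.+1) * n + (n - r).
    have : h.+1 * n <= P * n.
      rewrite leq_mul2r; apply/orP; right.
      have : h <= h * n by rewrite -{1}[h]muln1 leq_mul2l n_gt0 orbT.
      lia.
    by rewrite mulnBl; lia.
  by rewrite modnMDl modn_small //; lia.
rewrite En in neg.
case: (leqP q h) => [q_le_h|h_lt_q]; [right|left].
  have : q * n <= h * n by rewrite leq_mul2r q_le_h orbT.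
  lia.
have : h.+1 * n <= q * n by rewrite leq_mul2r h_lt_q orbT.
lia.
Qed.

(** With [h = x %/ 2 ^ c] and [r = x %% 2 ^ c], [2 ^ (m - c) * x] exceeds [h * n] by
    [2 ^ (m - c) * r - h]. Its gaps to [h * n] and [h.+1 * n], scaled by [2 ^ c], are the two
    inequalities. *)
Lemma leader_residues {m x} (n := 2 ^ m + 1) : coset_leader n x -> 0 < x ->
  forall c, 0 < c <= m ->
  (2 ^ c + 1) * x <= (x %% 2 ^ c) * n /\
  (x %% 2 ^ c) * n + 2 ^ c * x <= x + 2 ^ c * n.
Proof.
move=> leadx x_gt0 c /andP[c_gt0 c_le_m].
have := leader_gap leadx x_gt0 (m - c) (x %/ 2 ^ c).
have := leader_gap leadx x_gt0 (m - c) (x %/ 2 ^ c).+1.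
have Em : 2 ^ m = 2 ^ c * 2 ^ (m - c) by rewrite -expnD subnKC.
have Pc : 1 < 2 ^ c by rewrite -{1}(expn0 2) ltn_exp2l.
have Pj : 0 < 2 ^ (m - c) by rewrite expn_gt0.
have := divn_eq x (2 ^ c); have := ltn_pmod x (ltnW Pc).
rewrite -/n.
have En : n = 2 ^ c * 2 ^ (m - c) + 1 by rewrite /n Em.
move: (2 ^ c) (2 ^ (m - c)) (x %/ _) (x %% _) Pc Pj En => C J h r Pc Pj En r_lt Ex.
clear Em.
have hC : 2 * h <= h * C by rewrite mulnC leq_mul2l Pc orbT.
have rJ : J * r + J <= J * C by rewrite -mulnSr leq_mul2l r_lt orbT.
have EJx : J * x = h * (C * J) + J * r by rewrite {1}Ex; lia.
rewrite EJx !En => H1 H2; split.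
  case: H2 => H2; last by nia.
  have : C * (h + x) <= C * (J * r) by rewrite leq_mul2l; apply/orP; right; lia.
  lia.
case: H1 => H1; last by nia.
have : C * (J * r + x) <= C * (C * J + 1 + h) by rewrite leq_mul2l; apply/orP; right; lia.
lia.
Qed.
Lemma residues_leader {m x} (n := 2 ^ m + 1) : 0 < m -> 0 < x -> x < n ->
  (forall c, 0 < c <= m ->
     (2 ^ c + 1) * x <= (x %% 2 ^ c) * n /\
     (x %% 2 ^ c) * n + 2 ^ c * x <= x + 2 ^ c * n) ->
  coset_leader n x.
Proof.
move=> m_gt0 x_gt0 x_lt_n resx; split=> // _ [j ->].
(* The added upper bound makes the claim invariant under [r |-> n - r], which reduces an exponent
   [j >= m] to [j - m]. *)
suff: x <= (x * 2 ^ j) %% n <= n - x by case/andP.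
elim/ltn_ind: j => j IHj; have [m_le_j|j_lt_m] := leqP m j.
  have /IHj/andP[] : j - m < j by lia.
  have := divn_eq (x * 2 ^ (j - m)) n.
  set h := _ %/ n; set r := _ %% n => Ex x_le_r r_le.
  have -> : x * 2 ^ j = (x * 2 ^ (j - m) - h.+1) * n + (n - r).
    have Ej : x * 2 ^ j + x * 2 ^ (j - m) = x * 2 ^ (j - m) * n.
      by rewrite -{1}(subnK m_le_j) expnD /n; lia.
    have : h.+1 * n <= x * 2 ^ (j - m) * n.
      rewrite leq_mul2r; apply/orP; right.
      have : h * 1 <= h * n by rewrite leq_mul2l; apply/orP; right; lia.
      lia.
    by rewrite mulnBl; lia.
  by rewrite modnMDl modn_small; lia.
(* An exponent [j < m] is governed by the residue condition at [c = m - j]. *)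
have /resx : 0 < m - j <= m by lia.
have Em : 2 ^ m = 2 ^ (m - j) * 2 ^ j by rewrite -expnD subnK // ltnW.
have Pj : 0 < 2 ^ j by rewrite expn_gt0.
have Pc : 1 < 2 ^ (m - j) by rewrite -{1}(expn0 2) ltn_exp2l // subn_gt0.
have := divn_eq x (2 ^ (m - j)).
have En : n = 2 ^ (m - j) * 2 ^ j + 1 by rewrite /n Em.
move: (2 ^ (m - j)) (2 ^ j) (x %/ _) (x %% _) Pc Pj En => C J h r Pc Pj En Ex [].
move: x_lt_n; rewrite !En => x_lt_n lo hi.
have {}lo : x + h <= J * r.
  have: C * (x + h) <= C * (J * r) by lia.
  by rewrite leq_mul2l; case: (C) Pc.
have {}hi : J * r + x <= C * J + 1 + h.
  have: C * (J * r + x) <= C * (C * J + 1 + h) by lia.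
  by rewrite leq_mul2l; case: (C) Pc.
have -> : x * J = h * (C * J + 1) + (J * r - h) by rewrite {1}Ex; lia.
by rewrite modnMDl modn_small; lia.
Qed.

(** * The largest leader *)

Lemma leader_fifth t : coset_leader (2 ^ (4 * t + 2) + 1) ((2 ^ (4 * t + 2) + 1) %/ 5).
Proof.
have [D ED] : exists D, 2 ^ (4 * t + 2) + 1 = D * 5.
  apply/dvdnP.
  by rewrite /dvdn expnD expnM -modnDml -modnMml -modnXm exp1n.
rewrite ED mulnK //; split; first lia.
move=> _ [j ->]; rewrite -muln_modr leq_pmulr // lt0n -/(dvdn 5 _).
by rewrite Euclid_dvdX.
Qed.

Lemma above_second {t x} (n := 2 ^ (4 * t + 2) + 1) : coset_leader n x ->
  7 * n <= 40 * x -> 5 * x = n.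
Proof.
move=> leadx x_big.
have En : n = 4 * 16 ^ t + 1 by rewrite /n expnD expnM mulnC.
have [D ED] : exists D, n = D * 5.
  apply/dvdnP; rewrite /dvdn En -modnDml -modnMmr -modnXm.
  by rewrite exp1n.
have n_mod3 : n %% 3 = 2 by rewrite En -modnDml -modnMmr -modnXm exp1n.
have x_gt0 : 0 < x by lia.
have x_lt_n : x < n by case: leadx.
have gap := leader_gap leadx x_gt0; rewrite -/n in gap.
(* The first three gaps give [5 * x <= n] or [3 * x = n]; the last gives [n <= 5 * x] or
   [17 * x <= 3 * n]. *)
have := gap 0 1; have := gap 1 1; have := gap 2 1; have := gap 4 3.
rewrite !expnS !expn0 => g4 g2 g1 g0.
have [//|x_le] : 5 * x = n \/ 17 * x <= 3 * n.
  have : 3 * x <> n by move=> E; move: n_mod3; rewrite -E modnMr.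
  lia.
(* [D] is [n / 5], so [u] stays between [7 n / 40] and [n / 5]: the gap keeps [|16 u - 3 n|] at
   least [x], and [7 n / 40] is sent exactly to [n / 5]. *)
have orbit k : k <= t -> exists q u, [/\ 7 * D <= 8 * u, u <= D &
    2 ^ (4 * k) * x = q * n + u \/ 2 ^ (4 * k) * x + u = q * n].
  elim: k => [_|k IHk k_lt_t]; first by exists 0, x; split; lia.
  have [q [u [u_lo u_hi Eu]]] := IHk (ltnW k_lt_t).
  have E16 : 2 ^ (4 * k.+1) * x = 16 * (2 ^ (4 * k) * x).
    by rewrite mulnS expnD; lia.
  case: Eu => Eu.
    have := gap (4 * k.+1) (16 * q + 3); rewrite E16 => -[] g.
      by exists (16 * q + 3), ((16 * q + 3) * n - 16 * (2 ^ (4 * k) * x)); split; lia.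
    by exists (16 * q + 3), (16 * (2 ^ (4 * k) * x) - (16 * q + 3) * n); split; lia.
  have q_gt0 : 0 < q.
    by case: (q) Eu => //; rewrite mul0n; lia.
  have Eq : (16 * q - 3) * n + 3 * n = 16 * (q * n).
    by rewrite -mulnDl subnK; [rewrite mulnA | lia].
  have := gap (4 * k.+1) (16 * q - 3); rewrite E16 => -[] g.
    by exists (16 * q - 3), ((16 * q - 3) * n - 16 * (2 ^ (4 * k) * x)); split; lia.
  by exists (16 * q - 3), (16 * (2 ^ (4 * k) * x) - (16 * q - 3) * n); split; lia.
have [q [u [u_lo u_hi Eu]]] := orbit t (leqnn t).
(* Now [n] divides [4 * u + x] or [4 * u - x], yet both lie strictly between [0] and [n] because
   [17 * x <= 3 * n]. *)
have close : n * x = 4 * (2 ^ (4 * t) * x) + x by rewrite /n expnD; lia.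
case: Eu => Eu.
  have Ex : (x - 4 * q) * n = 4 * u + x by rewrite mulnBl; lia.
  have : 0 < x - 4 * q by case: (x - 4 * q) Ex => //; lia.
  case: (x - 4 * q) Ex => [//|[|p]] Ex _; first lia.
  by rewrite !mulSn in Ex; lia.
have Ex : (4 * q - x) * n = 4 * u - x by rewrite mulnBl; lia.
case: (4 * q - x) Ex => [|p]; first lia.
by rewrite mulSn; lia.
Qed.

(** * The second value and its hexadecimal digits *)

Definition second t := 2 ^ (4 * t - 1) + (2 ^ (4 * t) - 1) %/ 5.

Lemma expn16_mod5 k : 16 ^ k = 5 * ((16 ^ k - 1) %/ 5) + 1.
Proof.
have P : 0 < 16 ^ k by rewrite expn_gt0.
have : 5 %| 16 ^ k - 1 by rewrite -eqn_mod_dvd // -modnXm exp1n.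
by move=> /divnK; lia.
Qed.

Lemma secondE {t} : 0 < t -> 10 * second t + 2 = 7 * 16 ^ t.
Proof.
case: t => // t _; rewrite /second.
have -> : 4 * t.+1 - 1 = 4 * t + 3 by lia.
have -> : 2 ^ (4 * t.+1) = 16 ^ t.+1 by rewrite expnM.
rewrite expnD expnM -[2 ^ 4]/16 -[2 ^ 3]/8.
have := expn16_mod5 t.+1; rewrite expnS; lia.
Qed.

(** [(16 ^ k - 1) %/ 5] is [k] hexadecimal digits 3. The modulus is [8 * 16 ^ k] because the leading
    digit B agrees with 3 only in its low three bits. *)
Lemma second_digits {t k} : k < t ->
  exists H, second t = H * (8 * 16 ^ k) + (3 * 16 ^ k + (16 ^ k - 1) %/ 5).
Proof.
move=> k_lt_t; have := secondE (leq_ltn_trans (leq0n k) k_lt_t).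
have -> : 16 ^ t = 16 * 16 ^ k * 16 ^ (t - k.+1).
  by rewrite -expnS -expnD subnKC.
have := expn16_mod5 (t - k.+1); have := expn16_mod5 k.
move: ((16 ^ k - 1) %/ 5) ((16 ^ (t - k.+1) - 1) %/ 5) => R g.
move: (16 ^ k) (16 ^ (t - k.+1)) => B G EB EG E.
exists (7 * g + 1).
by rewrite EG in E; lia.
Qed.

(* [d2 / n] is about [7 / 40]; [central c r] says that [r / 2 ^ c] keeps this
   distance from [0] and [1], up to the [O(2 ^ - c)] terms of [leader_residues]. *)
Definition central c r :=
  (7 * (2 ^ c + 1) <= 40 * r) && (40 * r + 7 * 2 ^ c <= 40 * 2 ^ c + 7).

(** For [c < 4 * t], multiplying [central] by [16 ^ t] and using the bound on [x] gives the residue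
    conditions; for the last three [c], the remainder is [x] itself. *)
Lemma central_leader {t x} : 0 < t -> 0 < x -> 10 * x <= 7 * 16 ^ t ->
  (forall c, 0 < c < 4 * t -> central c (x %% 2 ^ c)) ->
  coset_leader (2 ^ (4 * t + 2) + 1) x.
Proof.
move=> t_gt0 x_gt0 x_le cenx.
have Em : 2 ^ (4 * t + 2) = 4 * 16 ^ t by rewrite expnD expnM mulnC.
apply: residues_leader; rewrite ?Em; [lia | lia | lia |].
move=> c /andP[c_gt0 c_le].
have [c_lt|c_ge] := ltnP c (4 * t).
  have /cenx/andP[] : 0 < c < 4 * t by rewrite c_gt0.
  move: (2 ^ c) (x %% 2 ^ c) (16 ^ t) x_le => C r A x_le lo hi.
  have loA : 7 * (C + 1) * A <= 40 * r * A by rewrite leq_mul2r lo orbT.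
  have hiA : (40 * r + 7 * C) * A <= (40 * C + 7) * A by rewrite leq_mul2r hi orbT.
  have xC : C * (10 * x) <= C * (7 * A) by rewrite leq_mul2l x_le orbT.
  have [C0|C_gt0] := posnP C; first by rewrite C0 in lo hi hiA *; lia.
  have r_le : r <= C by lia.
  split; first lia.
  have : C * (10 * x) + 7 * A <= C * (7 * A) + 10 * x.
    by have := leq_mul C_gt0 x_le; nia.
  lia.
have Ec : 2 ^ c = 16 ^ t * 2 ^ (c - 4 * t).
  by rewrite -[16]/(2 ^ 4) -expnM -expnD subnKC.
have C_ge : 16 ^ t <= 2 ^ c by rewrite Ec leq_pmulr // expn_gt0.
have x_lt : x < 2 ^ c by lia.
rewrite modn_small //.
have C_le : 2 ^ c <= 4 * 16 ^ t by rewrite -Em leq_pexp2l.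
split.
  by rewrite mulnC leq_mul2l leq_add2r C_le orbT.
have : x * (16 ^ t * 4) <= 2 ^ c * (4 * 16 ^ t + 1 - x).
  have := leq_mul C_ge (_ : 4 * x <= 4 * 16 ^ t + 1 - x); lia.
have : 2 ^ c * (4 * 16 ^ t + 1 - x) + 2 ^ c * x = 2 ^ c * (4 * 16 ^ t + 1).
  by rewrite -mulnDr subnK //; lia.
lia.
Qed.

(** For [i = 0, 1, 2, 3] the remainder is about 1/5, 3/5, 4/5, 2/5 of [2 ^ c]. The tightest margin,
    [16 ^ k / 40] at [i = 0], absorbs [s] once [16 ^ k >= 4096]. *)
Lemma central_high c k i s : 3 <= k -> s <= 102 -> i < 4 -> c = 4 * k + i ->
  central c ((3 * 16 ^ k + (16 ^ k - 1) %/ 5 - s) %% 2 ^ c).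
Proof.
move=> k_ge s_le i_lt ->.
have B_ge : 16 ^ 3 <= 16 ^ k by rewrite leq_pexp2l.
rewrite /central expnD expnM -[2 ^ 4]/16.
have := expn16_mod5 k.
rewrite -[16 ^ 3]/(64 * 64) in B_ge.
move: ((16 ^ k - 1) %/ 5) => R; move: (16 ^ k) B_ge => B B_ge EB.
case: i i_lt => [|[|[|[|//]]]] _.
- have -> : 3 * B + R - s = 3 * (B * 2 ^ 0) + (R - s) by lia.
  by rewrite modnMDl modn_small; lia.
- have -> : 3 * B + R - s = 1 * (B * 2 ^ 1) + (B + R - s) by lia.
  by rewrite modnMDl modn_small; lia.
- by rewrite modn_small; lia.
- by rewrite modn_small; lia.
Qed.

Lemma central_low s c : s \in [:: 0; 6; 96; 102] -> 0 < c < 12 ->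
  central c ((819 - s) %% 2 ^ c).
Proof.
move=> s_in /andP[c_gt0 c_lt].
have : all (fun s => all (fun c => central c ((819 - s) %% 2 ^ c)) (iota 1 11))
  [:: 0; 6; 96; 102] by vm_compute.
by move=> /allP/(_ _ s_in)/allP/(_ c); apply; rewrite mem_iota c_gt0.
Qed.

Lemma second_sub_leader t s : 2 < t -> s \in [:: 0; 6; 96; 102] ->
  coset_leader (2 ^ (4 * t + 2) + 1) (second t - s).
Proof.
move=> t_gt2 s_in; have t_gt0 : 0 < t by lia.
have s_le : s <= 102 by move: s_in; rewrite !inE; lia.
have A_ge : 16 ^ 3 <= 16 ^ t by rewrite leq_pexp2l.
rewrite -[16 ^ 3]/(64 * 64) in A_ge.
have E10 := secondE t_gt0.
apply: central_leader => //; [lia | lia |] => c /andP[c_gt0 c_lt].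
(* Below 12 bits only the digits 333, that is 819, matter, and the check is finite. *)
have [c_lt12|c_ge12] := ltnP c 12.
  have [H ->] := second_digits t_gt2.
  have -> : H * (8 * 16 ^ 2) + (3 * 16 ^ 2 + (16 ^ 2 - 1) %/ 5) - s =
      H * 2 ^ (11 - c) * 2 ^ c + (819 - s).
    by rewrite -mulnA -expnD subnK // addnBA //; apply: leq_trans s_le _.
  by rewrite modnMDl central_low // c_gt0.
have k_lt : c %/ 4 < t by rewrite ltn_divLR // mulnC.
have [H ->] := second_digits k_lt.
have k_ge : 3 <= c %/ 4 by rewrite leq_divRL.
have i_lt : c %% 4 < 4 by rewrite ltn_pmod.
have Ec : c = 4 * (c %/ 4) + c %% 4 by rewrite mulnC -divn_eq.
have B_ge : 16 ^ 3 <= 16 ^ (c %/ 4) by rewrite leq_pexp2l.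
rewrite -[16 ^ 3]/(64 * 64) in B_ge.
have -> : H * (8 * 16 ^ (c %/ 4)) + (3 * 16 ^ (c %/ 4) + (16 ^ (c %/ 4) - 1) %/ 5) - s =
    H * 2 ^ (3 - c %% 4) * 2 ^ c + (3 * 16 ^ (c %/ 4) + (16 ^ (c %/ 4) - 1) %/ 5 - s).
  have -> : H * 2 ^ (3 - c %% 4) * 2 ^ c = H * (8 * 16 ^ (c %/ 4)).
    rewrite -mulnA -expnD; congr (_ * _).
    have -> : 3 - c %% 4 + c = 3 + 4 * (c %/ 4) by lia.
    by rewrite expnD expnM.
  by rewrite addnBA //; lia.
by rewrite modnMDl; apply: central_high Ec.
Qed.

(* Dividing by [16 ^ t >= 16 ^ 3] makes the conditions independent of [t]; the
   term [2 ^ c %/ 4] absorbs the part of [second t - s] not proportional to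
   [16 ^ t], and still leaves only three candidates below. *)
Lemma residue_slack t s c r : 2 < t -> s <= 101 -> 0 < c <= 8 -> r < 2 ^ c ->
  (2 ^ c + 1) * (second t - s) <= r * (4 * 16 ^ t + 1) ->
  r * (4 * 16 ^ t + 1) + 2 ^ c * (second t - s) <=
    (second t - s) + 2 ^ c * (4 * 16 ^ t + 1) ->
  (7 * (2 ^ c + 1) <= 40 * r + 2 ^ c %/ 4) &&
  (40 * r + 7 * (2 ^ c - 1) <= 40 * 2 ^ c + 2 ^ c %/ 4).
Proof.
move=> t_gt2 s_le c_range r_lt lo hi.
have A_ge : 16 ^ 3 <= 16 ^ t by rewrite leq_pexp2l.
rewrite -[16 ^ 3]/(64 * 64) in A_ge.
have E10 : 10 * second t + 2 = 7 * 16 ^ t by apply: secondE; lia.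
have Ex : 10 * (second t - s) + 10 * s + 2 = 7 * 16 ^ t by lia.
move: (second t - s) (16 ^ t) A_ge Ex lo hi => x A A_ge Ex lo hi.
clear E10.
(* A strict error below [16 ^ t] disappears on dividing by [16 ^ t]. *)
have boundA p q : p * A < q * A + A -> p <= q.
  by rewrite -mulSnr ltn_mul2r => /andP[].
apply/andP; split; apply: boundA.
  move: c_range r_lt lo {hi}; case: c => [|[|[|[|[|[|[|[|[|c]]]]]]]]] //; rewrite !expnS expn0 /= => _; lia.
move: c_range r_lt hi {lo}; case: c => [|[|[|[|[|[|[|[|[|c]]]]]]]]] //; rewrite !expnS expn0 /= => _; lia.
Qed.

Lemma near_second_leader t s : 2 < t -> s <= 101 ->
  coset_leader (2 ^ (4 * t + 2) + 1) (second t - s) -> s \in [:: 0; 6; 96].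
Proof.
move=> t_gt2 s_le leadx.
have A_ge : 16 ^ 3 <= 16 ^ t by rewrite leq_pexp2l.
rewrite -[16 ^ 3]/(64 * 64) in A_ge.
have E10 : 10 * second t + 2 = 7 * 16 ^ t by apply: secondE; lia.
have x_gt0 : 0 < second t - s by lia.
have Em : 2 ^ (4 * t + 2) = 4 * 16 ^ t by rewrite expnD expnM mulnC.
pose slack c r := (7 * (2 ^ c + 1) <= 40 * r + 2 ^ c %/ 4) &&
  (40 * r + 7 * (2 ^ c - 1) <= 40 * 2 ^ c + 2 ^ c %/ 4).
(* 307 is 133 in hexadecimal: it has the low byte 33 of [second t], plus 256 so that subtracting [s]
   does not truncate. *)
have slack_s c : c \in iota 1 8 -> slack c ((307 - s) %% 2 ^ c).
  rewrite mem_iota ltnS => c_range; have /andP[c_gt0 c_le] := c_range.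
  have -> : (307 - s) %% 2 ^ c = (second t - s) %% 2 ^ c.
    have [H ->] := second_digits t_gt2.
    have -> : H * (8 * 16 ^ 2) + (3 * 16 ^ 2 + (16 ^ 2 - 1) %/ 5) - s =
        (H * 2 ^ (11 - c) + 2 * 2 ^ (8 - c)) * 2 ^ c + (307 - s).
      rewrite mulnDl -!mulnA -!expnD !subnK // ?(leq_trans c_le) //.
      by rewrite addnBA ?(leq_trans s_le) // -addnA.
    by rewrite modnMDl.
  have [|lo hi] := leader_residues leadx x_gt0 c; first by lia.
  rewrite Em in lo hi.
  by apply: residue_slack lo hi => //; rewrite ltn_pmod // expn_gt0.
have : all (fun s => all (fun c => slack c ((307 - s) %% 2 ^ c)) (iota 1 8)
    ==> (s \in [:: 0; 6; 96])) (iota 0 102) by vm_compute.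
move=> /allP/(_ s); rewrite mem_iota => /(_ s_le)/implyP; apply.
exact/allP.
Qed.

(** * The modulus 1025, for [t = 2] *)

Lemma leader_1025 x : 0 < x -> x < 1025 ->
  all (fun c => ((2 ^ c + 1) * x <= (x %% 2 ^ c) * 1025) &&
    ((x %% 2 ^ c) * 1025 + 2 ^ c * x <= x + 2 ^ c * 1025)) (iota 1 10) ->
  coset_leader 1025 x.
Proof.
move=> x_gt0 x_lt /allP resx.
apply: (@residues_leader 10) => // c c_range.
by apply/andP/resx; rewrite mem_iota ltnS.
Qed.

Lemma near_second_leader_1025 {x} : coset_leader 1025 x -> 155 < x <= 179 ->
  x \in [:: 171; 173; 179].
Proof.
move=> leadx x_range.
have x_gt0 : 0 < x by lia.
have : all (fun x => all (fun c => ((2 ^ c + 1) * x <= (x %% 2 ^ c) * 1025) &&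
    ((x %% 2 ^ c) * 1025 + 2 ^ c * x <= x + 2 ^ c * 1025)) (iota 1 6)
    ==> (x \in [:: 171; 173; 179])) (iota 156 24) by vm_compute.
move=> /allP/(_ x); rewrite mem_iota => /(_ x_range)/implyP; apply.
apply/allP => c; rewrite mem_iota => c_range; apply/andP.
by apply: (@leader_residues 10) => //; lia.
Qed.

Theorem theorem4p5 (t : nat) (ht : 2 <= t) :
  let m := 4 * t + 2 in
  let n := 2 ^ m + 1 in
  let d1 := n %/ 5 in
  let d2 := 2 ^ (4 * t - 1) + (2 ^ (4 * t) - 1) %/ 5 in
  let d3 := d2 - 6 in
  let d4 := if t == 2 then d2 - 8 else d2 - 96 in
  let d5 := if t == 2 then d2 - 24 else d2 - 102 in
  (coset_leader n d1 /\ coset_leader n d2 /\ coset_leader n d3 /\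
   coset_leader n d4 /\ coset_leader n d5) /\
  (forall x, coset_leader n x -> d5 < x -> x <= n - 1 ->
        x \in [:: d1; d2; d3; d4]).
Proof.
move=> m n d1 d2 d3 d4 d5.
have lead1 : coset_leader n d1 := leader_fifth t.
have d2E : d2 = second t by [].
(* [x > d2] gives [10 * x >= 7 * 16 ^ t + 8], hence [7 * n <= 40 * x]. *)
have above x : coset_leader n x -> d2 < x -> x = d1.
  move=> leadx x_gt; have := above_second leadx.
  have : 10 * second t + 2 = 7 * 16 ^ t by apply: secondE; lia.
  have En : n = 4 * 16 ^ t + 1 by rewrite /n /m expnD expnM mulnC.
  rewrite -/n /d1 => E10 /(_ ltac:(lia)) <-.
  by rewrite mulKn.
case: (eqVneq t 2) => [t2|t_neq2].
  have n1025 : n = 1025 by rewrite /n /m t2; vm_compute.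
  have d2_179 : d2 = 179 by rewrite /d2 t2; vm_compute.
  have -> : d4 = 171 by rewrite /d4 t2 d2_179.
  have -> : d5 = 155 by rewrite /d5 t2 d2_179.
  have -> : d3 = 173 by rewrite /d3 d2_179.
  split; [split=> // | move=> x leadx x_gt _].
    by rewrite n1025 d2_179; split; last (split; last split); 
      apply: leader_1025; vm_compute.
  rewrite inE; case: (ltnP d2 x) => [/above->//|x_le]; first by rewrite eqxx.
  rewrite n1025 in leadx; rewrite d2_179 in x_le *.
  have := near_second_leader_1025 leadx; rewrite x_gt x_le => /(_ isT).
  by rewrite !inE; case/or3P=> ->; rewrite ?orbT.
have t_gt2 : 2 < t by rewrite ltn_neqAle eq_sym t_neq2.
have -> : d4 = d2 - 96 by rewrite /d4 (negbTE t_neq2).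
have -> : d5 = d2 - 102 by rewrite /d5 (negbTE t_neq2).
split.
  split=> //; rewrite -[d2 in coset_leader n d2]subn0.
  by split; last (split; last split); apply: second_sub_leader.
move=> x leadx x_gt _.
rewrite inE; case: (ltnP d2 x) => [/above->//|x_le]; first by rewrite eqxx.
(* The strict bound [d2 - 102 < x] leaves a deficit [d2 - x] of at most 101. *)
have Ex : x = d2 - (d2 - x) by rewrite subKn.
have : d2 - x \in [:: 0; 6; 96].
  apply: (@near_second_leader t) => //; first lia.
  by rewrite -d2E -Ex.
rewrite {2 3}Ex /d3; move: (d2 - x) => s.
by rewrite !inE; case/or3P=> /eqP->; rewrite ?subn0 eqxx ?orbT.
Qed.
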